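(* Let $\mathbb{K}$ be a field of characteristic $0$, let $x\in\mathbb{K}$, let $(\mathfrak{g}_{\mathcal D},\circ)$ be the left pre-Lie algebra of dissection diagrams with parameter $x$, and let $a$ be the unique dissection diagram of degree $1$. Then the pre-Lie subalgebra of $\mathfrak{g}_{\mathcal D}$ generated by $a$ is not a free pre-Lie algebra, and the pre-Lie algebra $\mathfrak{g}_{\mathcal D}$ is not a free pre-Lie algebra either.
   Context: A left pre-Lie algebra is a vector space $\mathfrak g$ with a bilinear product $\circ$ such that $u\circ(v\circ w)-(u\circ v)\circ w=v\circ(u\circ w)-(v\circ u)\circ w$. It is free if it is isomorphic to the free left pre-Lie algebra on some vector space. Dissection diagrams. For $n\ge 0$ let $\Pi_n$ be the regular $(n+1)$-gon with vertices $0,1,\dots,n$ numbered clockwise; vertex $0$ is the root. For $0\le i\le n$, side $i$ goes from vertex $i$ to vertex $i+1$ (with $n+1$ read as $0$). A chord is a segment joining two distinct vertices (adjacent vertices are allowed; such a chord is distinct from the side). A dissection diagram of degree $n$ is a set of $n$ pairwise non-crossing chords (they may share endpoints) of $\Pi_n$ forming an acyclic graph, hence a spanning tree on $\{0,\dots,n\}$. All chords are oriented towards the root. $\mathrm{Ch}(D)$ is the set of chords of $D$. The diagram of degree $0$ is identified with $1$. Coproduct. $\mathcal H_D$ is the commutative polynomial algebra on dissection diagrams of positive degree, with $\Delta(D)=\sum_{C\subset \mathrm{Ch}(D)}x^{k_C(D)}q_C(D)\otimes r_C(D)$ (with $x^0=1$), extended multiplicatively; it is a graded connected Hopf algebra.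 Here the $p=|C|$ chords of $C$ cut the polygon into $p+1$ faces; for a face $\alpha$ let $S_C(\alpha)$ be the (nonempty) set of sides of the polygon bordering $\alpha$. $q_C(D)$ is obtained by contracting every chord of $C$ to a point: each face $\alpha$ becomes a polygon with set of sides $S_C(\alpha)$, rooted at the starting vertex of its side of minimal label, carrying the chords of $D$ not in $C$ that lie in $\alpha$; this is a dissection diagram, and $q_C(D)$ is the product of these over all faces. $r_C(D)$ is the dissection diagram of degree $p$ obtained by keeping the chords of $C$ and contracting all sides which are not the minimal side of their face, the root being the image of $0$. $k_C(D)$ is the number of chords of $C$ whose orientation in $D$ is opposite to their orientation (towards the root) in $r_C(D)$. $\mathfrak g_{\mathcal D}$ is the vector space with basis the dissection diagrams of positive degree, with product $D_1\circ D_2=\sum_D c(D_1,D_2;D)\,D$, where $c(D_1,D_2;D)$ is the coefficient of $D_1\otimes D_2$ in $\Delta(D)$ and $D$ runs over dissection diagrams; it is a left pre-Lie algebra. *)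

(* Defs.v *)
From HB Require Import structures.
From mathcomp Require Import all_boot all_order all_algebra.
From mathcomp Require Import finmap monalg.

Set Implicit Arguments.
Unset Strict Implicit.
Unset Printing Implicit Defensive.

Import GRing.Theory.
Local Open Scope ring_scope.

Section PreLie.
Context (K : fieldType).

Definition bilinear_op (L : lmodType K) (op : L -> L -> L) : Prop :=
  (forall u, linear (op u)) /\ (forall v, linear (fun u => op u v)).

Definition left_pre_lie (L : lmodType K) (op : L -> L -> L) : Prop :=
  bilinear_op op /\
  (forall u v w,
     op u (op v w) - op (op u v) w = op v (op u w) - op (op v u) w).

Definition op_morphism (L M : lmodType K) (opL : L -> L -> L)
    (opM : M -> M -> M) (f : L -> M) : Prop :=
  linear f /\ {morph f : u v / opL u v >-> opM u v}.

(* (F, op), with the map i, is the free left pre-Lie algebra on V: this is    *)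
(* its defining universal property.                                           *)
Definition free_pre_lie_on (V F : lmodType K) (op : F -> F -> F)
    (i : V -> F) : Prop :=
  [/\ left_pre_lie op, linear i &
    forall (L : lmodType K) (opL : L -> L -> L), left_pre_lie opL ->
    forall f : V -> L, linear f ->
    exists2 phi : F -> L, op_morphism op opL phi /\ (forall v, phi (i v) = f v)
      & forall psi : F -> L, op_morphism op opL psi ->
          (forall v, psi (i v) = f v) -> forall u, psi u = phi u].

(* The part S of (g, op) is a free pre-Lie algebra: it is the image of an     *)
(* injective morphism from the free pre-Lie algebra on some vector space.     *)
Definition is_free_pre_lie (g : lmodType K) (op : g -> g -> g)
    (S : g -> Prop) : Prop :=
  exists (V F : lmodType K) (opF : F -> F -> F) (i : V -> F),
    free_pre_lie_on opF i /\
    exists f : F -> g,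
      [/\ op_morphism opF op f, injective f
        & forall u, S u <-> exists t, f t = u].

Definition whole (g : lmodType K) (u : g) : Prop := True.

Definition op_subalgebra (g : lmodType K) (op : g -> g -> g)
    (S : g -> Prop) : Prop :=
  [/\ S 0, forall (k : K) u v, S u -> S v -> S (k *: u + v)
    & forall u v, S u -> S v -> S (op u v)].

Definition generated_by (g : lmodType K) (op : g -> g -> g) (a : g)
    (u : g) : Prop :=
  forall S : g -> Prop, op_subalgebra op S -> S a -> S u.

End PreLie.

Arguments whole {K g} u.

(* A chord is the pair of its endpoints (i, j) with i < j, and a finite set   *)
(* of chords is the list of its elements in increasing lexicographic order.   *)
Definition chord : Type := (nat * nat)%type.

Definition mkchord (u v : nat) : chord := (minn u v, maxn u v).

Definition chord_le (c d : chord) : bool :=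
  (c.1 < d.1)%N || (c.1 == d.1) && (c.2 <= d.2)%N.

Definition chord_lt (c d : chord) : bool :=
  (c.1 < d.1)%N || (c.1 == d.1) && (c.2 < d.2)%N.

Definition crossing (c d : chord) : bool :=
  (c.1 < d.1 < c.2)%N && (c.2 < d.2)%N || (d.1 < c.1 < d.2)%N && (d.2 < c.2)%N.

Definition adjacent (E : seq chord) (u v : nat) : bool :=
  ((u, v) \in E) || ((v, u) \in E).

(* The vertices at distance at most k from u, listed without repetition.      *)
Fixpoint ball (E : seq chord) (k u : nat) : seq nat :=
  if k is k'.+1 then
    let s := ball E k' u in
    undup (s ++ [seq c.2 | c <- E & c.1 \in s] ++ [seq c.1 | c <- E & c.2 \in s])
  else [:: u].

Definition linked (E : seq chord) (u v : nat) : bool :=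
  v \in ball E (size E).*2 u.

(* No chord closes a cycle with the other chords; see acyclicP. *)
Definition acyclic (E : seq chord) : bool :=
  all (fun c => ~~ linked (rem c E) c.1 c.2) E.

(* The degree is the number of chords, so that the vertices are               *)
(* 0, ..., size D, and so are the labels of the sides.                        *)
Definition is_dissection (D : seq chord) : bool :=
  [&& sorted chord_lt D,
      all (fun c => (c.1 < c.2 <= size D)%N) D,
      all (fun c => all (fun d => ~~ crossing c d) D) D
    & acyclic D].

Lemma ballP (E : seq chord) (k u v : nat) :
  reflect (exists p, [/\ (size p <= k)%N, path (adjacent E) u p & last u p = v])
          (v \in ball E k u).
Proof.
elim: k v => [|k IHk] v /=.
  rewrite inE; apply: (iffP eqP) => [->|]; first by exists [::].
  by case=> -[|w p] [//= _ _ <-].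
rewrite mem_undup !mem_cat; apply: (iffP or3P).
  case=> [/IHk[p [sp up lp]] | /mapP[c] | /mapP[c]].
  - by exists p; split=> //; apply: leqW.
  - rewrite mem_filter => /andP[/IHk[p [sp up lp]] cE] ->.
    exists (rcons p c.2); rewrite size_rcons rcons_path last_rcons up lp /=.
    by split=> //; rewrite /adjacent -surjective_pairing cE.
  - rewrite mem_filter => /andP[/IHk[p [sp up lp]] cE] ->.
    exists (rcons p c.1); rewrite size_rcons rcons_path last_rcons up lp /=.
    by split=> //; rewrite /adjacent -surjective_pairing cE orbT.
case=> p; case/lastP: p => [|p w] [].
  by move=> _ _ /= <-; constructor 1; apply/IHk; exists [::].
rewrite size_rcons rcons_path last_rcons => sp /andP[up /orP adj] <-.
have pb : last u p \in ball E k u by apply/IHk; exists p.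
case: adj => lE; [constructor 2 | constructor 3]; apply/mapP.
  by exists (last u p, w); rewrite // mem_filter lE pb.
by exists (w, last u p); rewrite // mem_filter lE pb.
Qed.

Lemma adjacent_sym (E : seq chord) : symmetric (adjacent E).
Proof. by move=> u v; rewrite /adjacent orbC. Qed.

Lemma linkedP (E : seq chord) (u v : nat) :
  reflect (exists2 p, path (adjacent E) u p & last u p = v) (linked E u v).
Proof.
apply: (iffP (ballP _ _ _ _)) => [[p [_ up lp]] | [p]]; first by exists p.
case/shortenP=> q uq; rewrite cons_uniq => /andP[_ q_uniq] _ lq.
exists q; split=> //.
have qE : {subset q <= map fst E ++ map snd E}.
  elim: q u uq {q_uniq lq} => //= w q IHq u /andP[adj wq] z.
  rewrite inE => /predU1P[-> | /(IHq w wq)//].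
  case/orP: adj => [/(map_f snd)|/(map_f fst)]; rewrite mem_cat /= => ->//.
  exact: orbT.
by have := uniq_leq_size q_uniq qE; rewrite size_cat !size_map addnn.
Qed.

Lemma acyclicP (E : seq chord) : uniq E -> all (fun c => c.1 < c.2)%N E ->
  reflect (forall p, (2 < size p)%N -> ~~ ucycleb (adjacent E) p) (acyclic E).
Proof.
move=> uE ordE.
have remP c d : d \in rem c E = (d != c) && (d \in E).
  by rewrite mem_rem_uniq // inE.
apply: (iffP allP) => [acE [|x [|y [|z q]]] // _ | noC c cE].
  apply/negP => /andP[/= /and3P[xy yz zq] /and4P[xN yN _ _]].
  have [xy' [xz yz']] : x != y /\ x != z /\ y != z.
    by move: xN yN; rewrite !inE !negb_or => /and3P[-> -> _] /andP[-> _].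
  have yN' : y \notin z :: rcons q x.
    move: yN; rewrite !inE mem_rcons inE !negb_or => /andP[-> ->].
    by rewrite eq_sym xy'.
  have sub c : c = (x, y) \/ c = (y, x) ->
      path (adjacent (rem c E)) y (z :: rcons q x).
    move=> cxy; apply/andP; split.
      rewrite /adjacent !remP; case: cxy => ->; rewrite !xpair_eqE.
        by rewrite ![y == x]eq_sym (negPf xy') [z == x]eq_sym (negPf xz).
      by rewrite eqxx [z == x]eq_sym (negPf xz) [z == y]eq_sym (negPf yz').
    elim: (rcons q x) (z) zq yN' => //= w s IHs u /andP[uw ws].
    rewrite !inE !negb_or => /and3P[yu yw ys].
    rewrite (IHs w ws) ?inE ?negb_or ?yw // andbT.
    rewrite /adjacent !remP; case: cxy => ->; rewrite !xpair_eqE.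
      by rewrite ![_ == y]eq_sym (negPf yu) (negPf yw) !andbF.
    by rewrite ![_ == y]eq_sym (negPf yu) (negPf yw).
  case/orP: xy => cE; have /negP[] := acE _ cE; apply/linkedP.
    exists (rev (belast y (z :: rcons q x))).
      have -> : (x, y).1 = last y (z :: rcons q x) by rewrite /= last_rcons.
      rewrite rev_path; rewrite (eq_path (e' := adjacent (rem (x, y) E))).
        by apply: sub; left.
      by move=> u v; apply: adjacent_sym.
    by rewrite /= rev_cons last_rcons.
  by exists (z :: rcons q x); [apply: sub; right | rewrite /= last_rcons].
apply/negP => /linkedP[p].
case/shortenP=> q cq uq _ lq.
have subE : subrel (adjacent (rem c E)) (adjacent E).
  by move=> u v; rewrite /adjacent !remP => /orP[]/andP[_ ->] //; apply: orbT.
have c12 := allP ordE c cE.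
suff q2 : (1 < size q)%N.
  have /negP[] := noC (c.1 :: q) q2.
  rewrite /ucycleb uq andbT /= rcons_path (sub_path subE cq) lq.
  by rewrite /adjacent -surjective_pairing cE orbT.
case: q cq lq {uq} => [_ /= e|w [|//] /= cw e]; first by rewrite e ltnn in c12.
move: cw; rewrite e andbT /adjacent !remP -surjective_pairing eqxx /=.
by case/andP=> _ /(allP ordE) /=; rewrite ltnNge ltnW.
Qed.

(* Dissection diagrams of positive degree. *)
Record diagram := Diagram {
  chords :> seq chord;
  _ : is_dissection chords && (chords != [::]) }.

HB.instance Definition _ := [isSub for chords].
HB.instance Definition _ := [Countable of diagram by <:].

Definition degree (D : diagram) : nat := size D.

Fixpoint subsets (T : Type) (s : seq T) : seq (seq T) :=
  if s is c :: s' then [seq c :: C | C <- subsets s'] ++ subsets s'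
  else [:: [::]].

Definition all_chords (n : nat) : seq chord :=
  [seq c <- [seq (i, j) | i <- iota 0 n.+1, j <- iota 0 n.+1] | (c.1 < c.2)%N].

Definition diagrams_of_degree (n : nat) : seq diagram :=
  pmap insub [seq E <- subsets (all_chords n) | size E == n].

Definition diagram1 : diagram := Diagram (isT : is_dissection [:: (0, 1)]%N && _).

Lemma diagram1_unique (D : diagram) : degree D = 1%N -> D = diagram1.
Proof.
case: D => -[|[i j] [|//]] //= H _; apply: val_inj => /=.
case/andP: H => /and4P[_ /= /andP[/andP[/= lij]]].
by case: j lij => [|[|j]] //; rewrite ltnS leqn0 => /eqP->.
Qed.

(* The chord c cuts the boundary of the polygon into two arcs; side s is on   *)
(* the one which goes clockwise from c.1 to c.2.                              *)
Definition on_arc (c : chord) (s : nat) : bool := (c.1 <= s < c.2)%N.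

Definition separated (C : seq chord) (s t : nat) : bool :=
  has (fun c => on_arc c s != on_arc c t) C.

(* A face is represented by the set of sides of the polygon on its border,    *)
(* listed in increasing order: here, the face which borders side s.           *)
Definition face (n : nat) (C : seq chord) (s : nat) : seq nat :=
  [seq t <- iota 0 n.+1 | ~~ separated C s t].

(* Each face is counted once, through its side of minimal label. *)
Definition minimal_sides (n : nat) (C : seq chord) : seq nat :=
  [seq s <- iota 0 n.+1 | all (separated C s) (iota 0 s)].

(* Contracting part of the boundary so that only the sides in S remain, and   *)
(* numbering the vertices clockwise from the start of the least side of S,    *)
(* vertex v becomes the vertex whose number is the number of sides of S which *)
(* are passed when going clockwise from 0 to v; passing all of them leads     *)
(* back to the root.                                                          *)
Definition relabel (S : seq nat) (v : nat) : nat :=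
  (count (fun s => s < v) S %% size S)%N.

Definition contract (S : seq nat) (E : seq chord) : seq chord :=
  sort chord_le [seq mkchord (relabel S c.1) (relabel S c.2) | c <- E].

(* For a chord c which crosses no chord of C and is not in C, this says that  *)
(* c lies in the face S: it has sides of this face on both arcs.              *)
Definition lies_in (S : seq nat) (c : chord) : bool :=
  has (on_arc c) S && ~~ all (on_arc c) S.

Definition q_face (D C : seq chord) (s : nat) : seq chord :=
  let S := face (size D) C s in
  contract S [seq c <- D | (c \notin C) && lies_in S c].

Definition r_part (D C : seq chord) : seq chord :=
  contract (minimal_sides (size D) C) C.

(* The chord between u and v, oriented towards the root 0, goes from u to v:  *)
(* v is on the side of the root once this chord is removed.                   *)
Definition oriented (D : seq chord) (u v : nat) : bool :=
  linked (rem (mkchord u v) D) v 0.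

Definition k_part (D C : seq chord) : nat :=
  let new := relabel (minimal_sides (size D) C) in
  count (fun c => oriented D c.1 c.2
                  != oriented (r_part D C) (new c.1) (new c.2)) C.

(* A diagram as an element of the algebra, the diagram of degree 0 being 1.   *)
(* It is only applied to dissection diagrams, so the default value occurs     *)
(* only for the empty one.                                                    *)
Definition gen (E : seq chord) : {cmonom diagram} :=
  if insub E is Some D then ucm D else mone.

Definition q_part (D C : seq chord) : {cmonom diagram} :=
  \big[mmul/mone]_(s <- minimal_sides (size D) C) gen (q_face D C s).

Section Algebra.
Context (K : fieldType) (x : K).

(* H_D is the polynomial algebra {malg K[{cmonom diagram}]}. Its tensor       *)
(* square has for basis the pairs of monomials, (m1, m2) being m1 (x) m2.     *)
Definition coproduct (D : diagram) :
    {malg K[({cmonom diagram} * {cmonom diagram})%type]} :=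
  \sum_(C <- subsets D)
     << x ^+ k_part D C *g (q_part D C, gen (r_part D C)) >>.

Definition structure_coef (D1 D2 D : diagram) : K :=
  (coproduct D)@_(ucm D1, ucm D2).

(* The coproduct is homogeneous, so that only the diagrams D whose degree is  *)
(* the sum of those of D1 and D2 contribute.                                  *)
Definition circ_diagram (D1 D2 : diagram) : {malg K[diagram]} :=
  \sum_(D <- diagrams_of_degree (degree D1 + degree D2))
     << structure_coef D1 D2 D *g D >>.

Definition circ (u v : {malg K[diagram]}) : {malg K[diagram]} :=
  \sum_(D1 <- msupp u) \sum_(D2 <- msupp v)
     (u@_D1 * v@_D2) *: circ_diagram D1 D2.

End Algebra.

(* Main.v *)
From HB Require Import structures.
Require Import Defs.
From mathcomp Require Import all_boot all_order all_algebra.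
From mathcomp Require Import finmap monalg.
From mathcomp Require Import ring.
Import GRing.Theory.
Local Open Scope ring_scope.

(** Write [u v] for the pre-Lie product. In the free pre-Lie algebra on [u], in
    its description by rooted trees, the element
      [2 (u (u u)) u + u (u (u u)) - 3 u ((u u) u)]
    is the corolla with three leaves. The proof compares two evaluations of it.

    At the diagram [a] of degree 1 the corolla vanishes ([corolla_diagram1]).
    The reason is that the coefficient of the corolla at a diagram [D] of
    degree 4 is proportional to the coefficient of [a a a (x) a] in the
    coproduct of [D] (this is the Oudom-Guin description of the enveloping
    algebra). A term of the coproduct whose right factor is [a] comes from a
    single chord, which cuts the polygon into two faces, so that its left
    factor is a product of at most two diagrams and never [a a a]. The identity
    involves only the diagrams of degree at most 4, and it is proved by
    expanding both products, with [x] as an indeterminate.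

    In a pre-Lie algebra of vector fields on the line, [f g = f * d g] for a
    derivation [d], the corolla at [f] is [f^3 * d (d (d f))]
    ([corolla_derivation]). For [d = X^2 d/dX] this is nonzero as soon as [f]
    has a nonzero coefficient at [X], in characteristic 0.

    Now suppose that a part of the algebra of diagrams which contains [a] is
    free on [V]. The coefficient at [a] vanishes on all products, so it is a
    morphism to the line with zero product; so is the coefficient at [X] on
    vector fields. Send [v] in [V] to [X], scaled by the coefficient of [v] at
    [a]. By freeness this extends to a morphism [phi] to vector fields, and by
    uniqueness of extensions the coefficient of [phi t] at [X] is the
    coefficient of [t] at [a], for every [t]. Hence [phi a] has coefficient 1 at
    [X], so its corolla is nonzero, whereas the corolla of [a] is zero. The
    argument ([not_free_of_corolla]) applies at once to the subalgebra
    generated by [a] and to the whole algebra. *)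

(** * The corolla with three leaves *)

(** The symmetric brace of three copies of [u] with root [u], expressed with the
    binary product alone. *)
Definition corolla {L : zmodType} (op : L -> L -> L) (u : L) : L :=
  op (op u (op u u)) u *+ 2 + op u (op u (op u u)) - op u (op (op u u) u) *+ 3.

Lemma op_morphism0 {K : fieldType} {L M : lmodType K} {opL : L -> L -> L}
    {opM : M -> M -> M} {f : L -> M} (fM : op_morphism opL opM f) : f 0 = 0.
Proof. by have := fM.1 (-1) 0 0; rewrite scaler0 addr0 scaleN1r addNr. Qed.

Lemma op_morphism_corolla {K : fieldType} {L M : lmodType K} {opL : L -> L -> L}
    {opM : M -> M -> M} {f : L -> M} (fM : op_morphism opL opM f) (u : L) :
  f (corolla opL u) = corolla opM (f u).
Proof.
case: fM => f_lin f_op.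
pose h := GRing.isLinear.Build K L M *:%R f f_lin.
pose g : {linear L -> M} := HB.pack f h.
have -> : f = g by [].
by rewrite /corolla raddfB raddfD !raddfMn /= !f_op.
Qed.

(** The symmetric brace of [f1, f2, f3] with root [g] is [f1 f2 f3 d^3 g] in
    vector fields: each leaf contributes its coefficient, and differentiates the
    root. *)
Lemma corolla_derivation {A : comNzRingType} {d : A -> A}
    (dD : {morph d : f g / f + g})
    (dM : forall f g, d (f * g) = d f * g + f * d g) (f : A) :
  corolla (fun f g => f * d g) f = f ^+ 3 * d (d (d f)).
Proof. by rewrite /corolla !(dM, dD); ring. Qed.

(** * Vector fields on the line *)

Section VectorFields.
Variable K : fieldType.

(** The factor [X^2] makes the derivation raise the order in [X] by one, so that
    no product of vector fields has a term of degree 1 in [X]. *)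
Definition derivation (f : {poly K}) : {poly K} := 'X^2 * f^`().

Lemma derivation_linear : linear derivation.
Proof. by move=> k f g; rewrite /derivation derivD derivZ mulrDr scalerAr. Qed.

HB.instance Definition _ :=
  GRing.isLinear.Build K {poly K} {poly K} *:%R derivation derivation_linear.

Lemma derivationM (f g : {poly K}) :
  derivation (f * g) = derivation f * g + f * derivation g.
Proof. by rewrite /derivation derivM; ring. Qed.

Definition field_op (f g : {poly K}) : {poly K} := f * derivation g.

(** With [d] for the derivation, [f (g h) - (f g) h] is [f g d^2 h], which is
    symmetric in [f] and [g]. *)
Lemma field_op_pre_lie : left_pre_lie field_op.
Proof.
split; first split.
- by move=> f k g h; rewrite /field_op linearP mulrDr scalerAr.
- by move=> f k g h; rewrite /field_op mulrDl scalerAl.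
by move=> f g h; rewrite /field_op !derivationM; ring.
Qed.

Lemma coef0_derivation (f : {poly K}) : (derivation f)`_0 = 0.
Proof. by rewrite /derivation coefXnM. Qed.

Lemma coefS_derivation (f : {poly K}) (k : nat) :
  (derivation f)`_k.+1 = f`_k *+ k.
Proof.
by rewrite /derivation coefXnM; case: k => [|k]; rewrite //= coef_deriv subn2.
Qed.

Lemma coef1_field_op (f g : {poly K}) : (field_op f g)`_1 = 0.
Proof.
rewrite coefM big_ord_recl big_ord1 /= coef0_derivation coefS_derivation.
by rewrite !mulr0 addr0.
Qed.

Lemma corolla_field_op (f : {poly K}) :
  corolla field_op f = f ^+ 3 * derivation (derivation (derivation f)).
Proof. exact: corolla_derivation (raddfD derivation) derivationM f. Qed.

Lemma corolla_field_op_neq0 (charK0 : [pchar K] =i pred0) (f : {poly K}) :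
  f`_1 != 0 -> corolla field_op f != 0.
Proof.
move=> f1; rewrite corolla_field_op mulf_neq0 ?expf_neq0 //.
  by apply: contraNneq f1 => ->; rewrite coef0.
(* X^k is sent to k X^(k+1): three derivations take c X to 6 c X^4, and no other
   term of f contributes to X^4. *)
suff: (derivation (derivation (derivation f)))`_4 != 0.
  by apply: contraNneq => ->; rewrite coef0.
rewrite !coefS_derivation mulr1n -mulrnA -mulr_natr mulf_neq0 //.
by rewrite ((pcharf0P K).1 charK0).
Qed.
End VectorFields.

(** * Obstruction to freeness *)

(** The functional [l] stands for the class of an element modulo decomposables; it
    ensures that the preimage of [a] in a free algebra has a nonzero component
    of degree 1, whatever the generators are, and this component can be mapped
    to a vector field of order 1. *)
Lemma not_free_of_corolla {K : fieldType} (charK0 : [pchar K] =i pred0)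
    {g : lmodType K} {op : g -> g -> g} {S : g -> Prop} {a : g} {l : g -> K} :
  linear (l : g -> K^o) -> (forall u v, l (op u v) = 0) ->
  S a -> l a != 0 -> corolla op a = 0 -> ~ is_free_pre_lie op S.
Proof.
move=> l_lin l_op Sa la rel [V [F [opF [i [[_ i_lin univ] [f [fM f_inj imf]]]]]]].
have [f_lin f_op] := fM; have [t fta] := (imf a).1 Sa.
have relt : corolla opF t = 0.
  by apply: f_inj; rewrite (op_morphism_corolla fM) fta rel (op_morphism0 fM).
have lf_lin : linear (l \o f : F -> K^o).
  by move=> k u v; rewrite /= f_lin l_lin.
have w_lin : linear (fun v => (l (f (i v))) *: 'X : {poly K}).
  by move=> k u v; rewrite i_lin f_lin l_lin scalerDl scalerA.
have [phi [phiM phi_i] _] := univ _ _ (field_op_pre_lie K) _ w_lin.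
have [phi_lin phi_op] := phiM.
(* The coefficient at X and the functional l both are morphisms to the algebra K
   with zero product, and they agree on the generators. *)
have triv : left_pre_lie (fun _ _ : K^o => 0 : K^o).
  by split=> //; split=> [u|v] k p q; rewrite scaler0 addr0.
have lfi_lin : linear (l \o f \o i : V -> K^o).
  by move=> k u v; rewrite /= i_lin f_lin l_lin.
have [psi _ psi_uniq] := univ _ _ triv _ lfi_lin.
have coef_phi : (phi t)`_1 = l (f t).
  rewrite (psi_uniq (fun u => (phi u)`_1)) ?(psi_uniq (fun u => l (f u))) //.
  - split=> [k u v|u v]; first exact: lf_lin.
    by rewrite f_op l_op.
  - split=> [k u v|u v]; first by rewrite phi_lin coefD coefZ.
    by rewrite phi_op coef1_field_op.
  by move=> v; rewrite phi_i coefZ coefX mulr1.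
have /negP[] : corolla (field_op K) (phi t) != 0.
  by apply: corolla_field_op_neq0; rewrite ?coef_phi ?fta.
by rewrite -(op_morphism_corolla phiM) relt (op_morphism0 phiM).
Qed.

(** * The coproduct in terms of lists of chords *)

Definition valid (E : seq chord) : bool := is_dissection E && (E != [::]).

(** Computations are made on lists of chords, because the proofs carried by
    diagrams do not reduce. *)
Definition to_diagram (E : seq chord) : diagram := insubd diagram1 E.

Definition dissections (n : nat) : seq (seq chord) :=
  [seq E <- subsets (all_chords n) | (size E == n) && valid E].

Lemma to_diagramK (E : seq chord) : valid E -> chords (to_diagram E) = E.
Proof. exact: insubdK. Qed.

Lemma to_diagram_chords (D : diagram) : to_diagram D = D.
Proof. exact: valKd. Qed.

Lemma pmap_insub (s : seq (seq chord)) :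
  pmap insub s = [seq to_diagram E | E <- s & valid E] :> seq diagram.
Proof.
elim: s => //= E s IHs; case: insubP => [D vE <-|nvE] /=; rewrite IHs.
  by rewrite /valid (valP D) /= to_diagram_chords.
by rewrite /valid (negPf nvE).
Qed.

Lemma diagrams_of_degreeE (n : nat) :
  diagrams_of_degree n = [seq to_diagram E | E <- dissections n].
Proof.
rewrite /diagrams_of_degree pmap_insub /dissections -filter_predI.
by congr map; apply: eq_filter => E /=; rewrite andbC.
Qed.

Lemma degree_gt0 (D : diagram) : (0 < degree D)%N.
Proof. by rewrite lt0n size_eq0; case/andP: (valP D). Qed.

(** Faces which carry no chord are left out: each contributes the unit of the
    polynomial algebra to [q_part]. *)
Definition factors (D C : seq chord) : seq (seq chord) :=
  [seq E <- [seq q_face D C s | s <- minimal_sides (size D) C] | valid E].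

Lemma gen_invalid (E : seq chord) : ~~ valid E -> gen E = mone.
Proof. by move=> nvE; rewrite /gen insubN. Qed.

Lemma gen_valid (E : seq chord) : valid E -> gen E = ucm (to_diagram E).
Proof. by move=> vE; rewrite /gen /to_diagram /insubd insubT. Qed.

Lemma ucm_inj : injective (@ucm diagram).
Proof.
move=> D D' /(congr1 (fun m : {cmonom diagram} => m D)).
by rewrite !cmU eqxx; case: eqP => // ->.
Qed.

Lemma chords_inj : injective chords.
Proof. exact: val_inj. Qed.

Lemma prod_ucm_eq_ucm (s : seq diagram) (D : diagram) :
  (\big[mmul/mone]_(E <- s) ucm E == ucm D) = (s == [:: D]).
Proof.
apply/eqP/eqP => [prodE | ->]; last by rewrite big_seq1.
have: size s = 1%N.
  rewrite -(mdegU D) -prodE mdeg_prod (eq_bigr (fun=> 1%N)) => [|E _].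
    by rewrite sum1_size.
  by rewrite mdegU.
case: s prodE => [|E []] //=; rewrite big_seq1 => /ucm_inj-> //.
Qed.

Lemma gen_eq_ucm (E : seq chord) (D : diagram) :
  (gen E == ucm D) = (E == D :> seq chord).
Proof.
have [vE | nvE] := boolP (valid E).
  by rewrite gen_valid // (inj_eq ucm_inj) -(inj_eq chords_inj) to_diagramK.
rewrite gen_invalid // eq_sym cm1_eq1; apply/esym/negP => /eqP ED.
by rewrite /valid ED (valP D) in nvE.
Qed.

(** Equality of monomials does not evaluate; the same test on lists of chords
    does. *)
Lemma q_part_eq_ucm (E C : seq chord) (D : diagram) :
  (q_part E C == ucm D) = (factors E C == [:: D : seq chord]).
Proof.
have -> : q_part E C = \big[mmul/mone]_(F <- map to_diagram (factors E C)) ucm F.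
  rewrite big_map big_filter big_map [RHS]big_mkcond; apply: eq_bigr => s _.
  by case: ifP => [/gen_valid | /negbT/gen_invalid].
rewrite prod_ucm_eq_ucm -(inj_eq (inj_map chords_inj)) -map_comp /=.
rewrite (_ : map _ _ = factors E C) // -[RHS]map_id; apply/eq_in_map => F.
by rewrite mem_filter => /andP[/to_diagramK].
Qed.

(** * Expansions with the parameter as an indeterminate *)

Section Expansions.
Variables (K : fieldType) (x : K).

(** The term [(c, k, D)] stands for [c x^k D]. *)
Definition term : Type := (int * nat * seq chord)%type.

Definition coef (t : term) : K := t.1.1%:~R * x ^+ t.1.2.

Definition expansion (s : seq term) : {malg K[diagram]} :=
  \sum_(t <- s) << coef t *g to_diagram t.2 >>.

Definition homogeneous (n : nat) (s : seq term) : bool :=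
  all (fun t => (size t.2 == n) && valid t.2) s.

Lemma expansion_cons (t : term) (s : seq term) :
  expansion (t :: s) = << coef t *g to_diagram t.2 >> + expansion s.
Proof. exact: big_cons. Qed.

Fixpoint add_term (t : term) (s : seq term) : seq term :=
  if s is u :: s' then
    if (t.1.2 == u.1.2) && (t.2 == u.2) then (t.1.1 + u.1.1, u.1.2, u.2) :: s'
    else u :: add_term t s'
  else [:: t].

Definition collect (s : seq term) : seq term := foldr add_term [::] s.

Lemma expansion_collect (s : seq term) : expansion (collect s) = expansion s.
Proof.
elim: s => //= t s IHs; rewrite [RHS]expansion_cons -{}IHs.
elim: (collect s) => [|u r IHr] /=; first exact: expansion_cons.
case: ifP => [/andP[/eqP tu /eqP Dtu] | _]; rewrite !expansion_cons.
  by rewrite addrA /coef tu Dtu -monalgUD -mulrDl -intrD.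
by rewrite IHr addrCA.
Qed.

Lemma homogeneous_collect (n : nat) (s : seq term) :
  homogeneous n (collect s) = homogeneous n s.
Proof.
rewrite /homogeneous; elim: s => //= t s <-.
elim: (collect s) => //= u r IHr.
case: ifP => [/andP[_ /eqP->] | _] /=; last by rewrite IHr andbCA.
by rewrite [RHS]andbA andbb.
Qed.

(** Each diagram [D] is cut only once along each set [C] of its chords, and the two
    factors are then looked up among the terms of [s] and [t]. *)
Definition product (m n : nat) (s t : seq term) : seq term :=
  collect (flatten [seq
    let q := factors D C in let r := r_part D C in
    flatten [seq [seq (b.1.1 * c.1.1, (b.1.2 + c.1.2 + k_part D C)%N, D)
                 | c <- t & r == c.2]
            | b <- s & q == [:: b.2]]
  | D <- dissections (m + n), C <- subsets D]).

Lemma homogeneous_product (m n : nat) (s t : seq term) :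
  homogeneous (m + n) (product m n s t).
Proof.
rewrite homogeneous_collect; apply/allP => u.
case/flattenP => _ /allpairsPdep[D [C [DD _ ->]]].
case/flatten_mapP => b _ /mapP[c _ ->] /=.
by move: DD; rewrite mem_filter => /andP[].
Qed.

Lemma structure_coefE (D1 D2 D : diagram) :
  structure_coef x D1 D2 D =
  \sum_(C <- subsets D |
         (factors D C == [:: D1 : seq chord]) && (r_part D C == D2))
     x ^+ k_part D C.
Proof.
rewrite /structure_coef /coproduct raddf_sum /= [RHS]big_mkcond.
apply: eq_bigr => C _.
by rewrite mcoeffU xpair_eqE q_part_eq_ucm gen_eq_ucm -mulrb.
Qed.

(** At a fixed diagram the product is a scalar-valued linear extension in each
    argument, and [mmap] is additive. *)
Lemma mcoeff_circ (u v : {malg K[diagram]}) (D : diagram) :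
  (circ x u v)@_D =
  mmap idfun (fun D1 => mmap idfun (fun D2 => (circ_diagram x D1 D2)@_D) v) u.
Proof.
rewrite /circ mmapE raddf_sum; apply: eq_bigr => D1 _ /=.
rewrite mmapE raddf_sum big_distrr; apply: eq_bigr => D2 _ /=.
by rewrite mcoeffZ mulrA.
Qed.

Lemma circ_bilinear (s t : seq term) :
  circ x (expansion s) (expansion t) =
  \sum_(b <- s) \sum_(c <- t)
     (coef b * coef c) *: circ_diagram x (to_diagram b.2) (to_diagram c.2).
Proof.
apply/malgP => D; rewrite mcoeff_circ /expansion !raddf_sum /=.
apply: eq_bigr => b _; rewrite mmapU raddf_sum [RHS]raddf_sum big_distrr.
by apply: eq_bigr => c _; rewrite /= mmapU mcoeffZ mulrA.
Qed.

Lemma dissectionsP (n : nat) (D : seq chord) : D \in dissections n -> valid D.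
Proof. by rewrite mem_filter => /andP[/andP[]]. Qed.

Lemma circ_diagramE (b c : seq chord) : valid b -> valid c ->
  circ_diagram x (to_diagram b) (to_diagram c) =
  \sum_(D <- dissections (size b + size c))
    \sum_(C <- subsets D | (factors D C == [:: b]) && (r_part D C == c))
      << x ^+ k_part D C *g to_diagram D >>.
Proof.
move=> vb vc; rewrite /circ_diagram /degree diagrams_of_degreeE big_map.
rewrite !to_diagramK // !big_seq; apply: eq_bigr => D /dissectionsP vD.
by rewrite structure_coefE !to_diagramK // raddf_sum.
Qed.

Lemma circ_expansion (m n : nat) (s t : seq term) :
  homogeneous m s -> homogeneous n t ->
  circ x (expansion s) (expansion t) = expansion (product m n s t).
Proof.
move=> /allP hs /allP ht; rewrite circ_bilinear.
under eq_big_seq => b /hs/andP[/eqP sb vb] do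
  under eq_big_seq => c /ht/andP[/eqP sc vc] do
    rewrite circ_diagramE // sb sc scaler_sumr.
under eq_bigr => b _ do rewrite exchange_big /=.
rewrite exchange_big /= expansion_collect /expansion big_flatten.
rewrite big_allpairs_dep /=.
apply: eq_bigr => D _.
under eq_bigr => b _.
  under eq_bigr => c _ do rewrite scaler_sumr big_mkcond /=.
  rewrite exchange_big /=; over.
rewrite exchange_big /=; apply: eq_bigr => C _.
rewrite big_flatten big_map big_filter [RHS]big_mkcond; apply: eq_bigr => b _.
case: eqP => _ /=; last by rewrite big1.
rewrite big_map big_filter [RHS]big_mkcond; apply: eq_bigr => c _.
case: eqP => // _.
apply/malgP => E; rewrite mcoeffZ !mcoeffU mulrnAr /coef /=; congr (_ *+ _).
by rewrite intrM !exprD; ring.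
Qed.

Definition scale (k : int) (s : seq term) : seq term :=
  [seq (k * t.1.1, t.1.2, t.2) | t <- s].

Lemma expansion_scale (k : int) (s : seq term) :
  expansion (scale k s) = expansion s *~ k.
Proof.
rewrite /expansion big_map mulrz_suml; apply: eq_bigr => t _ /=.
by rewrite -(raddfMz (mkmalgU _)) /= /coef /= intrM -mulrA mulrzl.
Qed.

Lemma expansion_cat (s t : seq term) :
  expansion (s ++ t) = expansion s + expansion t.
Proof. exact: big_cat. Qed.

(** Terms with the same diagram and the same power of [x] are merged, so a
    vanishing expansion is recognised for all values of [x] together. *)
Lemma expansion_eq0 (s : seq term) :
  all (fun t => t.1.1 == 0) (collect s) -> expansion s = 0.
Proof.
move=> /allP s0; rewrite -expansion_collect /expansion big_seq big1 //.
move=> t /s0/eqP s_t.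
by rewrite /coef s_t mul0r monalgU0.
Qed.

Definition corolla_terms (a : seq term) : seq term :=
  let aa := product 1 1 a a in
  let a_aa := product 1 2 a aa in
  scale 2 (product 3 1 a_aa a) ++ product 1 3 a a_aa ++
  scale (-3) (product 1 3 a (product 2 1 aa a)).

Lemma corolla_expansion (a : seq term) : homogeneous 1 a ->
  corolla (circ x) (expansion a) = expansion (corolla_terms a).
Proof.
move=> ha.
have comb r s t : expansion (scale 2 r ++ s ++ scale (-3) t) =
    expansion r *+ 2 + expansion s - expansion t *+ 3.
  by rewrite !expansion_cat !expansion_scale addrA.
(* comb is applied as a whole, because rewriting with its two ingredients would
   evaluate the products while matching. *)
have haa := homogeneous_product 1 1 a a.
have ha_aa := homogeneous_product 1 2 a (product 1 1 a a).
have haa_a := homogeneous_product 2 1 (product 1 1 a a) a.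
rewrite /corolla (circ_expansion 1 1 _ _ ha ha).
rewrite (circ_expansion 1 2 _ _ ha haa) (circ_expansion 2 1 _ _ haa ha).
rewrite (circ_expansion 3 1 _ _ ha_aa ha) (circ_expansion 1 3 _ _ ha ha_aa).
by rewrite (circ_expansion 1 3 _ _ ha haa_a) -comb.
Qed.

Lemma corolla_terms_vanish :
  all (fun t => t.1.1 == 0)
    (collect (corolla_terms [:: (1, 0%N, [:: (0, 1)%N])])).
Proof. by vm_compute. Qed.

Lemma corolla_diagram1 : corolla (circ x) << diagram1 >> = 0.
Proof.
have -> : << diagram1 >> = expansion [:: (1, 0%N, chords diagram1)].
  by rewrite /expansion big_seq1 (to_diagram_chords diagram1) /coef mul1r expr0.
rewrite corolla_expansion; last by vm_compute.
exact: expansion_eq0 corolla_terms_vanish.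
Qed.

Lemma mcoeff_diagram1_circ (u v : {malg K[diagram]}) : (circ x u v)@_diagram1 = 0.
Proof.
rewrite /circ raddf_sum big1 // => D1 _; rewrite raddf_sum big1 // => D2 _ /=.
rewrite mcoeffZ raddf_sum /= big_seq big1 ?mulr0 // => D.
rewrite mem_pmap_sub mem_filter => /andP[/eqP sD _]; rewrite mcoeffU.
case: eqP => // D1D; rewrite D1D in sD.
have := leq_add (degree_gt0 D1) (degree_gt0 D2).
by rewrite -sD.
Qed.

End Expansions.

Theorem corollary33 (K : fieldType) (charK0 : [pchar K] =i pred0) (x : K) :
  ~ is_free_pre_lie (circ x) (generated_by (circ x) << diagram1 >>) /\
  ~ is_free_pre_lie (circ x) whole.
Proof.
have l_lin : linear (mcoeff diagram1 : {malg K[diagram]} -> K^o).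
  by move=> k u v; rewrite mcoeffD mcoeffZ.
have l_a : (<< diagram1 >> : {malg K[diagram]})@_diagram1 != 0.
  by rewrite mcoeffUU oner_neq0.
have l_circ := mcoeff_diagram1_circ K x.
have a_rel := corolla_diagram1 K x.
by split; apply: (not_free_of_corolla charK0 l_lin l_circ _ l_a a_rel).
Qed.
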